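(* For every integer $n\ge 2$ and every integer $k\in[p_{n+1},\,2p_n\#]$, $$f_3(p_n\#+k)=f_3(k)+p_n\#.$$
   Context: $\mathbb N=\{1,2,3,\dots\}$. $p_n$ denotes the $n$-th prime ($p_1=2$) and $p_n\#=\prod_{k=1}^n p_k$ is the $n$-th primorial number. The function $f_3:\mathbb N\to\mathbb N$ is defined recursively by $f_3(1)=1$, $f_3(2)=3$, and, for each $n\ge 3$, $f_3(n)$ is the smallest positive integer that is not in $\{f_3(1),\dots,f_3(n-1)\}$ and is coprime with $f_3(n-1)$. *)

(* Defs.v *)
From mathcomp Require Import all_boot.

Set Implicit Arguments.
Unset Strict Implicit.
Unset Printing Implicit Defensive.

Lemma next_prime_ex (m : nat) : exists p, (m < p) && prime p.
Proof. by have [p ltmp pr_p] := prime_above m; exists p; rewrite ltmp. Qed.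

Definition next_prime (m : nat) : nat := ex_minn (next_prime_ex m).

(* Indexed from 1: nth_prime 1 = 2; the value nth_prime 0 = 0 is junk. *)
Definition nth_prime (n : nat) : nat := iter n next_prime 0.

Definition primorial (n : nat) : nat := \prod_(1 <= k < n.+1) nth_prime k.

(* s lists the earlier terms, most recent first. The guard 0 < head 0 s only
   serves to make the search total; it holds for every s = f3_hist n with
   0 < n. *)
Definition f3_candidate (s : seq nat) (m : nat) : bool :=
  (0 < head 0 s) ==> [&& 0 < m, m \notin s & coprime m (head 0 s)].

Lemma f3_candidate_ex (s : seq nat) : exists m, f3_candidate s m.
Proof.
exists (sumn s * head 0 s).+1; apply/implyP=> a_gt0 /=; apply/andP; split.
  apply/negP=> ms.
  have le_sumn x : x \in s -> x <= sumn s.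
    elim: s {ms a_gt0} => //= y s IHs; rewrite inE => /predU1P[->|/IHs le_xs].
      exact: leq_addr.
    exact: leq_trans le_xs (leq_addl _ _).
  by have := le_sumn _ ms; rewrite leqNgt ltnS leq_pmulr.
by rewrite /coprime -addn1 gcdnC gcdnMDl gcdn1.
Qed.

Definition f3_next (s : seq nat) : nat := ex_minn (f3_candidate_ex s).

(* f3_hist n = [:: f3 n; ...; f3 1] *)
Fixpoint f3_hist (n : nat) : seq nat :=
  match n with
  | 0 => [::]
  | 1 => [:: 1]
  | 2 => [:: 3; 1]
  | n'.+1 => f3_next (f3_hist n') :: f3_hist n'
  end.

(* The value f3 0 = 0 is junk. *)
Definition f3 (n : nat) : nat := head 0 (f3_hist n).

Lemma f3_1 : f3 1 = 1. Proof. by []. Qed.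

Lemma f3_2 : f3 2 = 3. Proof. by []. Qed.

Lemma f3_histS (n : nat) : f3_hist n.+1 = f3 n.+1 :: f3_hist n.
Proof. by case: n => [|[|n]]. Qed.

Lemma f3_rec (n : nat) : f3 n.+3 = f3_next (f3_hist n.+2).
Proof. by []. Qed.

Lemma f3_gt0 (n : nat) : 0 < n -> 0 < f3 n.
Proof.
elim: n => // -[|[|n]] // IHn _; have {IHn} a_gt0 := IHn isT.
rewrite f3_rec /f3_next.
by case: ex_minnP => m /implyP/(_ a_gt0)/and3P[].
Qed.

Lemma mem_f3_hist (n m : nat) :
  reflect (exists2 i, 1 <= i <= n & m = f3 i) (m \in f3_hist n).
Proof.
apply: (iffP idP) => [|[i]]; elim: n => [|n IHn] //.
- rewrite f3_histS inE => /predU1P[->|/IHn[i /andP[i_gt0 le_in] ->]].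
    by exists n.+1; rewrite ?leqnn.
  by exists i; rewrite // i_gt0 leqW.
- by case: i.
rewrite f3_histS inE => /andP[i_gt0]; rewrite leq_eqVlt => /predU1P[->|lt_in] Em.
  by rewrite Em eqxx.
by rewrite IHn ?orbT // i_gt0.
Qed.

Lemma f3P (n : nat) (fresh := fun m => forall i, 1 <= i < n -> m <> f3 i) :
  3 <= n ->
  [/\ 0 < f3 n, fresh (f3 n), coprime (f3 n) (f3 n.-1)
    & forall m, 0 < m -> fresh m -> coprime m (f3 n.-1) -> f3 n <= m].
Proof.
case: n @fresh => [|[|[|n]]] //= _.
rewrite f3_rec /f3_next; case: ex_minnP => m.
rewrite /f3_candidate -/(f3 n.+2) f3_gt0 // => /and3P[m_gt0 m_notin co_m] min_m.
split=> // [i lt_in Em|m' m'_gt0 m'_new co_m'].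
  by case/negP: m_notin; apply/mem_f3_hist; exists i.
apply: min_m; rewrite m'_gt0 co_m' andbT.
by apply/negP=> /mem_f3_hist[i le_in]; exact: m'_new.
Qed.

(* Main.v *)
Require Import Defs.
From mathcomp Require Import all_boot.
From mathcomp Require Import zify.

(** The sequence is a concatenation of explicit blocks.  Say that it is level
    at [e] when [e] is even, its first [e + 1] terms are exactly
    [1, ..., e + 1], and the last of them is [e].  Let [g] be the least prime
    that does not divide [e].  Every number strictly between [e + 1] and
    [e + g] shares a prime factor with [e], so the next term is [e + g]; the
    terms after it fill the gap [e + 2, ..., e + g - 1] in increasing order,
    because [e + 2] is coprime to [e + g] (a common prime would divide [g - 2],
    hence be an odd prime below [g], hence divide [e] and then [2]).  The
    sequence is then level at [e + g - 1] ([level_next]).  Since it is level at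
    [2], everything is determined by the levels and, at each level [e], by the
    least prime not dividing [e] ([levelE]).

    Write [P] for the [n]-th primorial and [p] for the next prime.  If
    [0 < e < 2 * P], adding [P] to [e] does not change the least prime not
    dividing it ([least_nondiv_shift]): this prime is below [p], hence seen
    modulo [P], unless [e = P], and then it is [p] for both [P] and [2 * P].
    Consequently, once [e] and [P + e] are both levels, the blocks starting
    there are translates of each other by [P] and lead to another such pair.
    It remains to find a first pair.  A block never jumps over an odd prime,
    nor over [P + 1] ([no_skip_level]), so [p - 1] and [P] are levels; and the
    block starting at [P], whose prime is [p], leads to the level
    [P + (p - 1)]. *)

(** * Primorials *)

Lemma next_primeP (m : nat) :
  [/\ m < next_prime m, prime (next_prime m)
    & forall p, m < p -> prime p -> next_prime m <= p].
Proof.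
rewrite /next_prime; case: ex_minnP => q /andP[lt_mq pr_q] min_q.
by split=> // p lt_mp pr_p; apply: min_q; rewrite lt_mp.
Qed.

Lemma nth_primeS (n : nat) : nth_prime n.+1 = next_prime (nth_prime n).
Proof. by []. Qed.

Lemma prime_nth_prime (n : nat) : prime (nth_prime n.+1).
Proof. by case: (next_primeP (nth_prime n)). Qed.

Lemma nth_prime_lt (n : nat) : nth_prime n < nth_prime n.+1.
Proof. by case: (next_primeP (nth_prime n)). Qed.

Lemma nth_prime_gt2 (n : nat) : 0 < n -> 2 < nth_prime n.+1.
Proof.
case: n => // n _; have := nth_prime_lt n.+1.
by have := prime_gt1 (prime_nth_prime n); lia.
Qed.

Lemma primorial0 : primorial 0 = 1.
Proof. by rewrite /primorial big_geq. Qed.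

Lemma primorialS (n : nat) :
  primorial n.+1 = primorial n * nth_prime n.+1.
Proof. by rewrite /primorial big_nat_recr. Qed.

Lemma prime_dvd_primorial (n r : nat) :
  prime r -> (r %| primorial n) = (r < nth_prime n.+1).
Proof.
move=> pr_r; elim: n => [|n IHn].
  have [_ _ min2] := next_primeP (nth_prime 0).
  rewrite primorial0 dvdn1 nth_primeS.
  have := min2 2 isT isT; have := prime_gt1 pr_r; lia.
rewrite primorialS Euclid_dvdM // IHn dvdn_prime2 ?prime_nth_prime //.
have [lt_p _ min_p] := next_primeP (nth_prime n.+1).
rewrite (nth_primeS n.+1).
have := min_p r; rewrite pr_r; lia.
Qed.

Lemma primorial_dvd (n e : nat) :
  (forall r, prime r -> r < nth_prime n.+1 -> r %| e) -> primorial n %| e.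
Proof.
elim: n => [|n IHn] dv_e; first by rewrite primorial0.
have lt_p := nth_prime_lt n.+1.
rewrite primorialS Gauss_dvd.
  apply/andP; split; last by apply: dv_e; rewrite ?prime_nth_prime.
  by apply: IHn => r pr_r lt_r; apply: dv_e => //; apply: ltn_trans lt_p.
by rewrite coprime_sym prime_coprime ?prime_nth_prime //
           prime_dvd_primorial ?prime_nth_prime ?ltnn.
Qed.

Lemma primorial_gt0 (n : nat) : 0 < primorial n.
Proof.
elim: n => [|n IHn]; first by rewrite primorial0.
by rewrite primorialS muln_gt0 IHn prime_gt0 ?prime_nth_prime.
Qed.

(** * The least prime not dividing a number *)

Definition least_nondiv (e g : nat) : Prop :=
  [/\ prime g, ~~ (g %| e) & forall r, prime r -> r < g -> r %| e].

Lemma least_nondiv_ex (e : nat) : 0 < e -> exists g, least_nondiv e g.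
Proof.
move=> e_gt0.
have ex_g : exists g, prime g && ~~ (g %| e).
  have [p lt_ep pr_p] := prime_above e; exists p; rewrite pr_p /=.
  by apply/negP => /(dvdn_leq e_gt0); lia.
case: (ex_minnP ex_g) => g /andP[pr_g ndv_g] min_g; exists g.
split=> // r pr_r lt_rg; apply/negPn/negP => ndv_r.
by have := min_g r; rewrite pr_r ndv_r => /(_ isT); lia.
Qed.

Lemma least_nondiv_coprime (e g : nat) :
  least_nondiv e g -> coprime (e + g) e.
Proof.
case=> pr_g ndv_g _; rewrite coprime_sym /coprime gcdnDl -/(coprime e g).
by rewrite coprime_sym prime_coprime.
Qed.

(** Any prime factor of [x - e] is smaller than [g], hence divides [e]. *)
Lemma least_nondiv_skipped (e g x : nat) :
  least_nondiv e g -> e.+1 < x < e + g ->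
  exists r, [/\ prime r, r < g, r %| e & r %| x].
Proof.
case=> pr_g _ dv_e /andP[lt_ex lt_xg].
have d_gt1 : 1 < x - e by lia.
exists (pdiv (x - e)).
have pr_r := pdiv_prime d_gt1.
have le_r : pdiv (x - e) <= x - e by apply: pdiv_leq; lia.
have lt_r : pdiv (x - e) < g by lia.
have r_e := dv_e _ pr_r lt_r.
split=> //; rewrite -[x in _ %| x](@subnK e); last by lia.
by rewrite dvdn_add ?pdiv_dvd.
Qed.

Lemma least_nondiv_even (e g : nat) :
  2 %| e -> least_nondiv e g -> odd g && (2 < g).
Proof.
move=> e_even [pr_g ndv_g _]; have g_neq2 : g != 2.
  by apply: contraNneq ndv_g => ->.
have := prime_gt1 pr_g; have := even_prime pr_g; case: (odd g); lia.
Qed.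

(** A common prime would divide [g - 2], so it would be odd and divide [e]. *)
Lemma coprime_gap_start (e g : nat) :
  2 %| e -> least_nondiv e g -> coprime e.+2 (e + g).
Proof.
move=> e_even ge; have /andP[g_odd g_gt2] := least_nondiv_even _ _ e_even ge.
have [pr_g _ dv_e] := ge.
apply/negPn/negP => nco.
have gcd_gt1 : 1 < gcdn e.+2 (e + g).
  by have := gcdn_gt0 e.+2 (e + g); move: nco; rewrite /coprime; lia.
have pr_r := pdiv_prime gcd_gt1; set r := pdiv _ in pr_r.
have /andP[r_e2 r_eg] : (r %| e.+2) && (r %| e + g).
  by rewrite -dvdn_gcd pdiv_dvd.
have r_g2 : r %| g - 2 by rewrite (_ : g - 2 = e + g - e.+2) ?dvdn_sub; lia.
have le_r : r <= g - 2 by apply: dvdn_leq; lia.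
have r_e : r %| e by apply: dv_e => //; lia.
have r_2 : r %| 2 by rewrite (_ : 2 = e.+2 - e) ?dvdn_sub; lia.
have Er : r = 2 by apply/eqP; rewrite -dvdn_prime2.
by move: r_g2; rewrite Er; lia.
Qed.

Lemma least_nondiv_primorial (n m : nat) :
  0 < m < nth_prime n.+1 ->
  least_nondiv (m * primorial n) (nth_prime n.+1).
Proof.
move=> /andP[m_gt0 lt_m]; have pr_p := prime_nth_prime n; split=> //.
  rewrite Euclid_dvdM // prime_dvd_primorial // ltnn orbF.
  by apply/negP => /(dvdn_leq m_gt0); lia.
by move=> r pr_r lt_r; rewrite dvdn_mull // prime_dvd_primorial.
Qed.

Lemma least_nondiv_uniq (e g h : nat) :
  least_nondiv e g -> least_nondiv e h -> g = h.
Proof.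
move=> [pr_g ndv_g dv_g] [pr_h ndv_h dv_h]; case: (ltngtP g h) => // lt.
  by rewrite dv_h in ndv_g.
by rewrite dv_g in ndv_h.
Qed.

Lemma least_nondiv_ge_primorial (n e g : nat) :
  least_nondiv e g -> nth_prime n.+1 <= g -> primorial n %| e.
Proof.
case=> _ _ dv_e le_pg; apply: primorial_dvd => r pr_r lt_r.
by apply: dv_e => //; lia.
Qed.

(** Below the next prime, divisibility only depends on the residue modulo the
    primorial.  A least prime beyond that range forces [e] to be a multiple of
    the primorial, hence equal to it. *)
Lemma least_nondiv_shift (n e g : nat) :
  0 < n -> 0 < e < 2 * primorial n ->
  least_nondiv e g -> least_nondiv (primorial n + e) g.
Proof.
move=> n_gt0 /andP[e_gt0 e_lt] ge.
case: (ltnP g (nth_prime n.+1)) => [lt_gp | le_pg].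
  have dvd_shift r : prime r -> r <= g -> (r %| primorial n + e) = (r %| e).
    move=> pr_r le_rg; apply: dvdn_addr.
    by rewrite prime_dvd_primorial //; lia.
  case: ge => pr_g ndv_g dv_e.
  split=> // [|r pr_r lt_r]; first by rewrite dvd_shift.
  by rewrite dvd_shift ?dv_e // ltnW.
have p_gt2 := nth_prime_gt2 n n_gt0.
have Ee : e = primorial n.
  have /dvdnP[c Ec] := least_nondiv_ge_primorial _ _ _ ge le_pg.
  have := primorial_gt0 n; rewrite Ec in e_gt0 e_lt *.
  case: c {Ec} e_gt0 e_lt => [|[|c]]; nia.
have p_P := least_nondiv_primorial n 1; have p_2P := least_nondiv_primorial n 2.
rewrite Ee in ge *; rewrite mul1n in p_P; rewrite addnn -mul2n.
have -> : g = nth_prime n.+1.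
  by apply: (least_nondiv_uniq _ _ _ ge); apply: p_P; lia.
by apply: p_2P; lia.
Qed.

(** * The block structure of the sequence *)

Lemma f3_eq (n m : nat) :
  2 <= n -> 0 < m -> m \notin f3_hist n -> coprime m (f3 n) ->
  (forall m', 0 < m' < m -> m' \notin f3_hist n -> ~~ coprime m' (f3 n)) ->
  f3 n.+1 = m.
Proof.
case: n => [|[|n]] // _ m_gt0 m_new m_co m_min.
rewrite f3_rec /f3_next; case: ex_minnP => x.
rewrite /f3_candidate -/(f3 n.+2) f3_gt0 //= => /and3P[x_gt0 x_new x_co] min_x.
have le_xm : x <= m by apply: min_x; rewrite m_gt0 m_new.
apply/eqP; rewrite eqn_leq le_xm leqNgt; apply/negP => lt_xm.
by have := m_min x; rewrite x_gt0 lt_xm x_co => /(_ isT x_new).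
Qed.

Definition level (e : nat) : Prop :=
  [/\ 0 < e, 2 %| e, f3 e.+1 = e
    & forall m, (m \in f3_hist e.+1) = (0 < m <= e.+1)].

Lemma level2 : level 2.
Proof.
have f3_3 : f3 3 = 2 by apply: f3_eq => // -[|[|m]].
by split=> // m; rewrite f3_histS f3_3 !inE; lia.
Qed.

Section Block.

Variables e g : nat.
Hypotheses (lev_e : level e) (g_e : least_nondiv e g).

Lemma block_jump : f3 e.+2 = e + g.
Proof.
have [e_gt0 e_even fe hist_e] := lev_e.
have /andP[_ g_gt2] := least_nondiv_even _ _ e_even g_e.
apply: f3_eq; rewrite ?hist_e ?fe; try lia; first exact: least_nondiv_coprime.
move=> x x_lt; rewrite hist_e => x_new.
have [|r [pr_r _ r_e r_x]] := least_nondiv_skipped e g x g_e; first by lia.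
apply/negP => /eqP co; have : r %| 1 by rewrite -co dvdn_gcd r_x.
by rewrite dvdn1; have := prime_gt1 pr_r; lia.
Qed.

(** The used numbers are part of the induction: they show that the next
    number of the gap is the least unused one. *)
Lemma block_fill (i : nat) : 0 < i < g ->
  f3 (e + i).+1 = (if i == 1 then e + g else e + i) /\
  (forall m, (m \in f3_hist (e + i).+1) = (0 < m <= e + i) || (m == e + g)).
Proof.
have [e_gt0 e_even fe hist_e] := lev_e.
have /andP[_ g_gt2] := least_nondiv_even _ _ e_even g_e.
elim: i => // -[|i] IHi i_lt.
  rewrite addn1 block_jump; split=> // m.
  by rewrite f3_histS inE hist_e block_jump orbC.
have [|f_i hist_i] := IHi; first by lia.
have f_i1 : f3 (e + i.+2).+1 = e + i.+2.
  rewrite addnS; apply: f3_eq; rewrite ?hist_i ?f_i; try lia.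
    case: eqP => [[->]|_]; first by rewrite addn1 coprime_gap_start.
    by rewrite addnS coprimeSn.
  by move=> x x_lt; rewrite hist_i; lia.
split=> // m; rewrite f3_histS inE f_i1 addnS hist_i; lia.
Qed.

Lemma level_next : level (e + g).-1.
Proof.
have [e_gt0 e_even fe hist_e] := lev_e.
have /andP[g_odd g_gt2] := least_nondiv_even _ _ e_even g_e.
have [|f_g hist_g] := block_fill g.-1; first by lia.
have Eg : (e + g).-1 = e + g.-1 by lia.
split; rewrite ?Eg; try lia.
  by rewrite f_g; case: eqP; lia.
by move=> m; rewrite hist_g; lia.
Qed.

Lemma levelE (k : nat) : e.+1 < k <= e + g ->
  f3 k = if k == e.+2 then e + g else k.-1.
Proof.
move=> k_in; have [|f_k _] := block_fill (k.-1 - e); first by lia.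
have Ek : e + (k.-1 - e) = k.-1 by lia.
have Ej : (k.-1 - e == 1) = (k == e.+2) by lia.
by rewrite Ek Ej prednK in f_k; last lia.
Qed.

End Block.

(** * Levels below a given number *)

Lemma level_block_ex (x : nat) : 3 <= x ->
  exists e g, [/\ level e, least_nondiv e g & e < x < e + g].
Proof.
elim: x => // x IHx; rewrite leq_eqVlt => /predU1P[<-|x_ge].
  have [//|g g_2] := least_nondiv_ex 2; exists 2, g; split=> //.
    exact: level2.
  by have /andP[_ g_gt2] := least_nondiv_even 2 g isT g_2; lia.
have [//|e [g [lev_e g_e x_in]]] := IHx.
have [lt_x | ge_x] := ltnP x.+1 (e + g); first by exists e, g; split=> //; lia.
have lev_x : level x.
  by have := level_next _ _ lev_e g_e; rewrite (_ : (e + g).-1 = x); last lia.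
have [x_gt0 x_even _ _] := lev_x; have [h h_x] := least_nondiv_ex x x_gt0.
exists x, h; split=> //.
by have /andP[_ h_gt2] := least_nondiv_even x h x_even h_x; lia.
Qed.

(** By [level_block_ex], [x] belongs to a block; it is either the index just
    before the jump or a number jumped over, which the hypothesis excludes. *)
Lemma no_skip_level (x : nat) : 3 <= x ->
  (forall e g, 0 < e -> e.+1 < x -> least_nondiv e g -> e + g <= x) ->
  level x.-1.
Proof.
move=> x_ge3 no_skip; have [e [g [lev_e g_e x_in]]] := level_block_ex x x_ge3.
have [e_gt0 _ _ _] := lev_e.
have [lt_ex | le_xe] := ltnP e.+1 x.
  by have := no_skip e g e_gt0 lt_ex g_e; lia.
by rewrite (_ : x.-1 = e) //; lia.
Qed.

(** A prime [p] has no common prime factor with a smaller [e > 0]. *)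
Lemma level_prime (p : nat) : prime p -> 2 < p -> level p.-1.
Proof.
move=> pr_p p_gt2; apply: no_skip_level => // e g e_gt0 lt_ep g_e.
rewrite leqNgt; apply/negP => lt_p.
have [|r [pr_r _ r_e]] := least_nondiv_skipped e g p g_e; first by lia.
rewrite dvdn_prime2 // => /eqP Er; rewrite Er in r_e.
by have := dvdn_leq e_gt0 r_e; lia.
Qed.

(** A block jumping over [primorial n + 1] would start at some [e] sharing a
    prime with it.  That prime does not divide [primorial n], so all primes up
    to the [n]-th divide [e], which is too small for that. *)
Lemma level_primorial (n : nat) : 0 < n -> level (primorial n).
Proof.
move=> n_gt0.
have P_ge2 : 2 <= primorial n.
  apply: dvdn_leq; first exact: primorial_gt0.
  by rewrite prime_dvd_primorial // nth_prime_gt2.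
apply: (no_skip_level (primorial n).+1) => // e g e_gt0 lt_e g_e.
rewrite leqNgt; apply/negP => lt_P.
have [|r [pr_r lt_rg r_e r_P1]] :=
  least_nondiv_skipped e g (primorial n).+1 g_e.
  by rewrite lt_P lt_e.
have r_notP : ~~ (r %| primorial n).
  apply/negP => r_P; have : r %| 1 by rewrite -(dvdn_addr 1 r_P) addn1.
  by rewrite dvdn1; have := prime_gt1 pr_r; lia.
rewrite prime_dvd_primorial // in r_notP.
have P_e : primorial n %| e.
  by apply: (least_nondiv_ge_primorial n e g g_e); lia.
by have := dvdn_leq e_gt0 P_e; lia.
Qed.

(** * Translation by a primorial *)

(** The two blocks around [x] and [primorial n + x] start at levels [e] and
    [primorial n + e] and have the same length.  The first such pair comes from
    [level_prime] and from the block starting at [primorial n]; at the end of a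
    pair of blocks, [level_next] gives the next pair, as long as
    [least_nondiv_shift] keeps the lengths equal. *)
Lemma level_pair_ex (n x : nat) :
  0 < n -> nth_prime n.+1 <= x <= 2 * primorial n ->
  exists e g, [/\ level e, level (primorial n + e), least_nondiv e g,
    least_nondiv (primorial n + e) g &
    [&& nth_prime n.+1 <= e.+1, e.+1 <= x & x < e + g]].
Proof.
move=> n_gt0; have pr_p := prime_nth_prime n.
have p_gt2 := nth_prime_gt2 n n_gt0.
(* A pair of levels at [e] is usable for [x] as soon as [e + 1 = x]. *)
have start e : nth_prime n.+1 <= e.+1 <= 2 * primorial n ->
    level e -> level (primorial n + e) ->
    exists e' g, [/\ level e', level (primorial n + e'), least_nondiv e' g,
      least_nondiv (primorial n + e') g &
      [&& nth_prime n.+1 <= e'.+1, e'.+1 <= e.+1 & e.+1 < e' + g]].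
  move=> e_in lev_e lev_Pe; have [e_gt0 e_even _ _] := lev_e.
  have [g g_e] := least_nondiv_ex e e_gt0; exists e, g; split=> //.
    by apply: least_nondiv_shift => //; lia.
  by have /andP[_ g_gt2] := least_nondiv_even e g e_even g_e; lia.
elim: x => [|x IHx] x_in; first by lia.
have [lt_px | le_xp] := ltnP (nth_prime n.+1) x.+1; last first.
  have Ex : x = (nth_prime n.+1).-1 by lia.
  apply: start => //; first by rewrite Ex; apply: level_prime.
  have p_P := least_nondiv_primorial n 1; rewrite mul1n in p_P.
  have := level_next _ _ (level_primorial n n_gt0) (p_P _).
  by rewrite (_ : (_ + _).-1 = primorial n + x); [apply; lia | lia].
have [|e [g [lev_e lev_Pe g_e g_Pe e_in]]] := IHx; first by lia.
have [lt_x | ge_x] := ltnP x.+1 (e + g); first by exists e, g; split=> //; lia.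
apply: start => //.
  by have := level_next _ _ lev_e g_e; rewrite (_ : (e + g).-1 = x); last lia.
have := level_next _ _ lev_Pe g_Pe.
by rewrite (_ : (primorial n + e + g).-1 = primorial n + x); last lia.
Qed.

Theorem theorem2p8 (n k : nat) (hn : 2 <= n)
    (hk : nth_prime n.+1 <= k <= 2 * primorial n) :
  f3 (primorial n + k) = f3 k + primorial n.
Proof.
have n_gt0 : 0 < n by lia.
have [lt_pk | le_kp] := ltnP (nth_prime n.+1) k.
  have [|e [g [lev_e lev_Pe g_e g_Pe e_in]]] := level_pair_ex n k.-1 n_gt0.
    by lia.
  rewrite (levelE _ _ lev_e g_e k); last by lia.
  rewrite (levelE _ _ lev_Pe g_Pe); last by lia.
  rewrite (_ : (primorial n + k == _) = (k == e.+2)); last by lia.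
  by case: eqP; lia.
(* Here [k = e + 1]: it precedes the block starting at [e], and both values are
   prescribed by the levels themselves. *)
have [//|e [g [[_ _ f_e _] [_ _ f_Pe _] _ _ e_in]]] := level_pair_ex n k n_gt0.
have -> : k = e.+1 by lia.
by rewrite addnS f_e f_Pe addnC.
Qed.
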